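(* Let $A$ be a commutative unital real algebra, let $Q$ be an Archimedean quadratic module of $A$, and let $M$ be a unital cone of $A$. If $a\in A$ satisfies $\chi(a)>0$ for all characters $\chi$ of $A$ with $\chi\in\mathrm{char}(A;M)$ and $\chi\in\mathrm{char}(A;Q)$ (that is, for all $\chi\in\mathrm{char}(A;M)\cap\mathrm{char}(A;Q)$), then $a\in\varepsilon+\mathrm{cone}(M,Q)$ for some $\varepsilon>0$.
   Context: For $\alpha\in\mathbb{R}$ we write $\alpha$ for $\alpha\cdot 1$ in $A$. A cone in $A$ is a subset $C\subseteq A$ with $\lambda c\in C$ and $c+d\in C$ for all $c,d\in C$ and real $\lambda\ge 0$; it is unital if $1\in C$. A unital cone $C$ of $A$ is a quadratic module of $A$ if $a^2b\in C$ for all $b\in C$, $a\in A$, and it is Archimedean if for each $a\in A$ there is $\lambda>0$ with $\lambda-a\in C$ and $\lambda+a\in C$. For unital cones $M,Q$ of $A$, $\mathrm{cone}(M,Q)$ is the set of all finite sums $\sum_{k=1}^r a_kq_k$ with $r\in\mathbb{N}$, $a_k\in M$, $q_k\in Q$. A character of $A$ is a unital algebra homomorphism $A\to\mathbb{R}$. For a subset $C\subseteq A$, $\mathrm{char}(A;C)$ is the set of characters $\chi$ of $A$ with $\chi(c)\ge 0$ for all $c\in C$. *)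

(* Defs.v *)
From mathcomp Require Import all_boot all_order all_algebra.
From mathcomp Require Import all_classical all_reals.

Set Implicit Arguments.
Unset Strict Implicit.
Unset Printing Implicit Defensive.

Import Order.TTheory GRing.Theory Num.Theory.

Local Open Scope classical_set_scope.
Local Open Scope ring_scope.

Section Cones.
Variables (R : realType) (A : comAlgType R).
Implicit Types C M Q : set A.

Definition cone C : Prop :=
  (forall (l : R) c, 0 <= l -> C c -> C (l *: c)) /\
  (forall c d, C c -> C d -> C (c + d)).

Definition unital_cone C : Prop := cone C /\ C 1.

Definition quadratic_module C : Prop :=
  unital_cone C /\ (forall a b, C b -> C (a ^+ 2 * b)).

Definition archimedean C : Prop :=
  forall a, exists2 l : R, 0 < l & C (l%:A - a) /\ C (l%:A + a).

Definition cone_prod M Q : set A :=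
  [set x | exists (r : nat) (m q : 'I_r -> A),
     [/\ forall k, M (m k), forall k, Q (q k) & x = \sum_(k < r) m k * q k]].

(* Scalars act on the target R by multiplication. *)
Definition character : Type := {lrmorphism A -> R | *%R}.

Definition char_on C : set character :=
  [set chi : character | forall c, C c -> 0 <= chi c].

End Cones.

(* Main.v *)
From HB Require Import structures.
Require Import Defs.
From mathcomp Require Import all_boot all_order all_algebra.
From mathcomp Require Import all_classical all_reals.
From mathcomp Require Import ring lra.

(** The products of elements of [M] with elements of [Q] generate a cone [C]
    that is stable under multiplication by squares, because [Q] is; so [C] is
    a quadratic module. It contains [Q], hence is Archimedean, and it contains
    [M], hence a character nonnegative on [C] lies in both [char_on M] and
    [char_on Q] ([cone_prod_qm]). What remains is Jacobi's Positivstellensatz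
    for one Archimedean quadratic module ([jacobi_positivstellensatz]): an
    element [a] that is positive at all characters nonnegative on [C] lies in
    [e + C] for some real [e > 0].

    Consider the quadratic module of all [c - s a] with [c] in [C] and [s] a
    sum of squares. If it does not contain [-1], Zorn's lemma embeds it in a
    maximal proper quadratic module [P]. Maximality makes [P] a total
    preordering of [A], in the sense that [x] or [- x] lies in [P]
    ([maximal_proper_total]). As [P] is Archimedean, every [x] is infinitely
    close to a unique real, and taking this real is a character that is
    nonnegative on [P] ([maximal_proper_character]). It is nonnegative on [C]
    and at [- a], contrary to the hypothesis.

    So [-1 = c - s a], that is, [s a - 1] lies in [C]. Such a certificate has
    the unknown factor [s] in front of [a]; an identity due to Marshall removes
    it, by improving any bound [a + r] in [C] by a fixed amount as long as
    [r >= 0] ([archimedean_certificate_step]). The Archimedean property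
    supplies a first bound, and after finitely many improvements [r] is
    negative. *)

Set Implicit Arguments.
Unset Strict Implicit.
Unset Printing Implicit Defensive.

Import Order.TTheory GRing.Theory Num.Theory.

Local Open Scope classical_set_scope.
Local Open Scope ring_scope.

Section Positivstellensatz.
Variables (R : realType) (A : comAlgType R).
Implicit Types (P Q M C : set A) (a b c s x y : A) (k l r e : R).

(** * Quadratic modules *)

Lemma qmD P x y : quadratic_module P -> P x -> P y -> P (x + y).
Proof. by move=> [[[_ PD] _] _]; exact: PD. Qed.

Lemma qmZ P l x : quadratic_module P -> 0 <= l -> P x -> P (l *: x).
Proof. by move=> [[[PZ _] _] _]; exact: PZ. Qed.

Lemma qm_sqrM P a x : quadratic_module P -> P x -> P (a ^+ 2 * x).
Proof. by move=> [_ PM]; exact: PM. Qed.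

Lemma qm_scalar P l : quadratic_module P -> 0 <= l -> P l%:A.
Proof. by move=> qP l0; apply: qmZ => //; case: qP => -[]. Qed.

Lemma qm0 P : quadratic_module P -> P 0.
Proof. by move=> qP; rewrite -(scale0r 1); exact: qm_scalar. Qed.

Lemma qm_sqr P a : quadratic_module P -> P (a ^+ 2).
Proof.
move=> qP; rewrite -(mulr1 (a ^+ 2)); apply: qm_sqrM => //.
by case: qP => -[].
Qed.

Lemma qmZ_inv P l x : quadratic_module P -> 0 < l -> P (l *: x) -> P x.
Proof.
move=> qP l0 /(qmZ qP (ltW (_ : 0 < l^-1))); rewrite invr_gt0 => /(_ l0).
by rewrite scalerA mulVf ?gt_eqF// scale1r.
Qed.

(** The support of a quadratic module is an ideal because every [y] is a
    difference of squares, [4 y = (y + 1)^2 - (y - 1)^2]. *)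
Lemma qm_support_ideal P x y :
  quadratic_module P -> P x -> P (- x) -> P (y * x).
Proof.
move=> qP Px PNx; apply: (@qmZ_inv _ 4%:R) => //.
have -> : 4%:R *: (y * x) = (y + 1) ^+ 2 * x + (y - 1) ^+ 2 * - x.
  by rewrite scaler_nat; ring.
by apply: qmD => //; apply: qm_sqrM.
Qed.

Lemma qm_proper_scalar P l :
  quadratic_module P -> ~ P (- 1) -> P l%:A -> 0 <= l.
Proof.
move=> qP properP Pl; rewrite leNgt; apply/negP => l0; apply: properP.
apply: (@qmZ_inv _ (- l)) => //; first by rewrite oppr_gt0.
by rewrite scaleNr scalerN opprK.
Qed.

(** The least quadratic module, which consists of the sums of squares; this
    description makes closure properties follow from those of quadratic
    modules. *)
Definition sos : set A := [set s | forall P, quadratic_module P -> P s].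

Lemma sos_qm : quadratic_module sos.
Proof.
split; first split; first split.
- by move=> l c l0 sc P qP; apply: qmZ => //; exact: sc.
- by move=> c d sc sd P qP; apply: qmD => //; [exact: sc|exact: sd].
- by move=> P [[]].
- by move=> a b sb P qP; apply: qm_sqrM => //; exact: sb.
Qed.

Lemma sos_sub P s : quadratic_module P -> sos s -> P s.
Proof. by move=> qP ss; exact: ss. Qed.

(** The multipliers that map [x] into [P] form a quadratic module once they
    contain [1], so they contain [sos]. *)
Lemma sosM P s x : quadratic_module P -> sos s -> P x -> P (s * x).
Proof.
move=> qP ss Px; suff : quadratic_module [set t | P (t * x)] by move/ss.
split; first split; first split => /=.
- by move=> l c l0 Pc; rewrite -scalerAl; exact: qmZ.
- by move=> c d Pc Pd; rewrite mulrDl; exact: qmD.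
- by rewrite /= mul1r.
- by move=> a b Pb; rewrite /= -mulrA; exact: qm_sqrM.
Qed.

Definition adjoin P x : set A :=
  [set y | exists c s, [/\ P c, sos s & y = c + s * x]].

Lemma adjoin_qm P x : quadratic_module P -> quadratic_module (adjoin P x).
Proof.
move=> qP; have qS := sos_qm; split; first split; first split.
- move=> l _ l0 [c [s [Pc Ss ->]]]; exists (l *: c), (l *: s).
  by rewrite scalerDr -scalerAl; split => //; [exact: qmZ|exact: (qmZ qS)].
- move=> _ _ [c [s [Pc Ss ->]]] [d [t [Pd St ->]]]; exists (c + d), (s + t).
  by rewrite mulrDl addrACA; split => //; [exact: qmD|exact: (qmD qS)].
- exists 1, 0; rewrite mul0r addr0; split=> //; first by case: qP => -[].
  exact: (qm0 qS).
- move=> b _ [c [s [Pc Ss ->]]]; exists (b ^+ 2 * c), (b ^+ 2 * s).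
  by rewrite mulrDr mulrA; split => //; [exact: qm_sqrM|exact: (qm_sqrM _ qS)].
Qed.

Lemma sub_adjoin P x : P `<=` adjoin P x.
Proof.
move=> c Pc; exists c, 0; rewrite mul0r addr0; split=> //.
exact: (qm0 sos_qm).
Qed.

Lemma mem_adjoin P x : quadratic_module P -> adjoin P x x.
Proof.
move=> qP; exists 0, 1; rewrite mul1r add0r; split=> //; first exact: qm0.
by case: sos_qm => -[].
Qed.

Lemma archimedeanS P Q : Q `<=` P -> archimedean Q -> archimedean P.
Proof.
move=> QP archQ a; have [l l0 [? ?]] := archQ a.
by exists l => //; split; apply: QP.
Qed.

(** * Maximal proper quadratic modules *)

Definition maximal_proper P :=
  ~ P (- 1) /\
  forall P', quadratic_module P' -> ~ P' (- 1) -> P `<=` P' -> P' `<=` P.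

(** Zorn's lemma is applied to the sets [X] such that [Q `|` X] is a proper
    quadratic module, so that the empty chain has the bound [set0]. *)
Lemma exists_maximal_proper Q : quadratic_module Q -> ~ Q (- 1) ->
  exists P, [/\ quadratic_module P, Q `<=` P & maximal_proper P].
Proof.
move=> qQ properQ.
pose good X := quadratic_module (Q `|` X) /\ ~ (Q `|` X) (- 1).
have [F Fgood Ftot|X [[qX properX] maxX]] := @Zorn_bigcup A good.
  (* Adding set0 to the chain accounts for the elements of Q, and leaves each
     finite family inside a single Q `|` X. *)
  have in1 x : (Q `|` \bigcup_(X in F) X) x ->
      exists2 X, (F `|` [set set0]) X & (Q `|` X) x.
    case=> [Qx|[X FX Xx]]; first by exists set0; [right|left].
    by exists X; [left|right].
  have qm1 X : (F `|` [set set0]) X -> quadratic_module (Q `|` X).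
    by case=> [/Fgood[]//|->]; rewrite setU0.
  have out X : (F `|` [set set0]) X -> Q `|` X `<=` Q `|` \bigcup_(X in F) X.
    case=> [FX|->] x [Qx|Xx]; [by left|by right; exists X|by left|by []].
  split; last first.
    by move/in1 => [X [/Fgood[]//|->]]; rewrite setU0.
  split; first split; first split.
  - move=> l c l0 /in1[X FX Xc]; apply: (out X FX).
    by apply: qmZ => //; exact: qm1.
  - move=> c d /in1[X FX Xc] /in1[Y FY Yd].
    have [XY|YX] : X `<=` Y \/ Y `<=` X.
      move: FX FY => [FX|->]; last by left.
      move=> [FY|->]; last by right.
      exact: Ftot.
    + apply: (out Y FY); apply: qmD => //; first exact: qm1.
      by case: Xc => [?|/XY ?]; [left|right].
    + apply: (out X FX); apply: qmD => //; first exact: qm1.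
      by case: Yd => [?|/YX ?]; [left|right].
  - by left; case: qQ => -[].
  - move=> a b /in1[X FX Xb]; apply: (out X FX).
    by apply: qm_sqrM => //; exact: qm1.
exists (Q `|` X); split=> //; split=> // P' qP' properP' QXP'.
have QP' : Q `|` P' = P' by apply/setUidPr => x Qx; apply: QXP'; left.
apply: contrapT => P'notX; apply: (maxX P').
  split=> [x Xx|P'X]; first by apply: QXP'; right.
  by apply: P'notX => x /P'X; right.
by rewrite /good QP'.
Qed.

(** If neither [x] nor [- x] lay in [P], then [-1 = c + s x] and
    [-1 = d - t x] for some [c, d] in [P] and sums of squares [s, t].
    Eliminating [x] gives [s + t + t c + s d = 0], whence [t] lies in the
    support of [P]; as the support is an ideal, [-1 = d - t x] lies in [P]. *)
Lemma maximal_proper_total P x :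
  quadratic_module P -> maximal_proper P -> P x \/ P (- x).
Proof.
move=> qP [properP maxP].
have adjoinN1 z : ~ P z -> adjoin P z (- 1).
  move=> nPz; apply: contrapT => proper_z; apply: nPz.
  apply: (maxP (adjoin P z)) => //; [exact: adjoin_qm|exact: sub_adjoin|].
  exact: mem_adjoin.
apply: contrapT => /not_orP[/adjoinN1[c [s [Pc Ss es]]]].
move=> /adjoinN1[d [t [Pd St et]]].
have PNt : P (- t).
  have -> : - t = s + t * c + s * d.
    have -> : c = - 1 - s * x by rewrite es; ring.
    have -> : d = - 1 + t * x by rewrite et; ring.
    by ring.
  apply: (qmD qP); last exact: sosM.
  by apply: (qmD qP); [exact: sos_sub|exact: sosM].
apply: properP; rewrite et mulrC; apply: qmD => //.
by apply: qm_support_ideal => //; exact: sos_sub.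
Qed.

(** * The character of a maximal proper quadratic module *)

(** [x] is infinitely close to [r] for the preordering defined by [P]. For a
    maximal proper Archimedean [P] this relation is the graph of a character;
    arguing with the relation keeps suprema out of the algebra. *)
Definition near P x r : Prop :=
  forall e, 0 < e -> P (e%:A + (x - r%:A)) /\ P (e%:A - (x - r%:A)).

Lemma nearD P x y r l : quadratic_module P ->
  near P x r -> near P y l -> near P (x + y) (r + l).
Proof.
move=> qP xr yl e e0; have e20 : 0 < e / 2 by rewrite divr_gt0.
have [xr1 xr2] := xr _ e20; have [yl1 yl2] := yl _ e20.
rewrite [e]splitr !scalerDl.
by split; [move: (qmD qP xr1 yl1)|move: (qmD qP xr2 yl2)];
  congr (P _); ring.
Qed.

Lemma nearZ P x k r : quadratic_module P -> near P x r -> near P (k *: x) (k * r).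
Proof.
move=> qP xr e e0.
have l0 : 0 < `|k| + 1 by rewrite ltr_pwDr.
(* The denominator |k| + 1 is positive even when k = 0. *)
have [P1 P2] := xr _ (divr_gt0 e0 l0).
have PE : P ((e * (`|k| / (`|k| + 1)))%:A + k *: (x - r%:A)) /\
          P ((e * (`|k| / (`|k| + 1)))%:A - k *: (x - r%:A)).
  have -> : e * (`|k| / (`|k| + 1)) = `|k| * (e / (`|k| + 1)) by ring.
  move: P1 P2; set d := e / _; set y := x - _ => P1 P2.
  rewrite -scalerA; case: (ger0P k) => k0.
    by split; [rewrite -scalerDr|rewrite -scalerBr]; apply: qmZ.
  have {}k0 : 0 <= - k by rewrite oppr_ge0 ltW.
  by split; [move: (qmZ qP k0 P2)|move: (qmZ qP k0 P1)];
    rewrite scalerDr ?scalerN !scaleNr ?opprK.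
have Pd : P (e - e * (`|k| / (`|k| + 1)))%:A.
  apply: qm_scalar => //; rewrite subr_ge0 ler_piMr ?(ltW e0)//.
  by rewrite ler_pdivrMr// mul1r lerDl.
move: PE; rewrite scalerBr scalerA => -[P3 P4].
by split; [move: (qmD qP Pd P3)|move: (qmD qP Pd P4)];
  rewrite addrA -scalerDl subrK.
Qed.

Lemma near1 P : quadratic_module P -> near P 1 1.
Proof.
by move=> qP e e0; rewrite scale1r subrr subr0 addr0; split;
  apply: qm_scalar => //; exact: ltW.
Qed.

(** It suffices to treat [y = x - r], which satisfies [near P y 0]. Then
    [e - y^2] lies in [P] for [e = d^2], since
    [2 d (d^2 - y^2) = (d - y)^2 (d + y) + (d + y)^2 (d - y)]. *)
Lemma near_sqr P x r : quadratic_module P -> near P x r ->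
  near P (x ^+ 2) (r ^+ 2).
Proof.
move=> qP xr; pose y := x - r%:A.
have y2 : near P (y ^+ 2) 0.
  move=> e e0; rewrite scale0r subr0; split.
    by apply: (qmD qP); [apply: qm_scalar => //; exact: ltW|exact: qm_sqr].
  pose d := Num.sqrt e; have d0 : 0 < d by rewrite sqrtr_gt0.
  have -> : e%:A = d%:A ^+ 2 :> A.
    by rewrite exprZn expr1n sqr_sqrtr// ltW.
  have [P1 P2] := xr _ d0; rewrite -/y in P1 P2.
  apply: (@qmZ_inv _ (2 * d)) => //; first by rewrite mulr_gt0.
  rewrite -[_ *: (_ - _)]mulr_algl -(scalerA 2 d) scaler_nat.
  move: (qmD qP (qm_sqrM (d%:A - y) qP P1) (qm_sqrM (d%:A + y) qP P2)).
  by congr (P _); ring.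
have := nearD qP y2 (nearD qP (nearZ (2 * r) qP xr)
                             (nearZ (- r ^+ 2) qP (near1 qP))).
have -> : 0 + (2 * r * r + - r ^+ 2 * 1) = r ^+ 2 by ring.
suff -> : y ^+ 2 + ((2 * r) *: x + (- r ^+ 2) *: 1) = x ^+ 2 by [].
rewrite /y -[_ *: x]mulr_algl -(scalerA 2 r) scaler_nat scaleNr.
have -> : (r ^+ 2)%:A = r%:A ^+ 2 :> A by rewrite exprZn expr1n.
by ring.
Qed.

Lemma near_ge0 P x r : quadratic_module P -> ~ P (- 1) ->
  P x -> near P x r -> 0 <= r.
Proof.
move=> qP properP Px xr; rewrite leNgt; apply/negP => r0.
have r20 : 0 < - r / 2 by lra.
have [_ P2] := xr _ r20.
have : 0 <= r / 2.
  apply: (qm_proper_scalar qP properP); move: (qmD qP Px P2).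
  have {2}-> : r = r / 2 + r / 2 by lra.
  by rewrite mulNr scaleNr !scalerDl; congr (P _); ring.
lra.
Qed.

Lemma near_unique P x r l : quadratic_module P -> ~ P (- 1) ->
  near P x r -> near P x l -> r = l.
Proof.
move=> qP properP xr xl.
have near0 k l' : near P x k -> near P x l' -> 0 <= k - l'.
  move=> xk xl'; apply: (near_ge0 qP properP (qm0 qP)).
  by have := nearD qP xk (nearZ (-1) qP xl'); rewrite scaleN1r mulN1r subrr.
by apply/eqP; rewrite eq_le; apply/andP; split; rewrite -subr_ge0; exact: near0.
Qed.

(** Take the supremum of the reals [r] with [x - r] in [P]. Totality turns
    [x - (sup + e)] not in [P] into the upper estimate that [near] asks for. *)
Lemma near_exists P x : quadratic_module P -> archimedean P -> maximal_proper P ->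
  exists r, near P x r.
Proof.
move=> qP archP maxP; have [properP _] := maxP.
have [l l0 [Plx PlNx]] := archP x.
pose E := [set r | P (x - r%:A)].
have Ebound : ubound E l.
  move=> r Er; rewrite -subr_ge0; apply: (qm_proper_scalar qP properP).
  by move: (qmD qP Plx Er); rewrite scalerBl; congr (P _); ring.
have Esup : has_sup E.
  by split; [exists (- l); rewrite /E /= scaleNr opprK addrC|exists l].
exists (sup E) => e e0; split.
  have [r Er ltr] := sup_adherent e0 Esup.
  have : P (r - (sup E - e))%:A by apply: qm_scalar => //; rewrite subr_ge0 ltW.
  by move/(qmD qP Er); rewrite !scalerBl; congr (P _); ring.
have [PN|] := maximal_proper_total (x - (sup E + e)%:A) qP maxP.
  have : sup E + e <= sup E by apply: ub_le_sup => //; case: Esup.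
  by rewrite gerDl leNgt e0.
by rewrite scalerDl; congr (P _); ring.
Qed.

(** Additivity of [near] reduces multiplicativity to squares, by
    [4 x y = (x + y)^2 - (x - y)^2]. *)
Lemma maximal_proper_character P :
  quadratic_module P -> archimedean P -> maximal_proper P ->
  exists chi : character A, forall x, P x -> 0 <= chi x.
Proof.
move=> qP archP maxP; have [properP _] := maxP.
have /choice[f fP] x := near_exists x qP archP maxP.
have fE x r : near P x r -> f x = r.
  by move=> xr; exact: near_unique (fP x) xr.
have f_linear : linear_for *%R f.
  by move=> k x y; apply: fE; apply: nearD => //; exact: nearZ.
have f_monoid : monoid_morphism f.
  split; first by apply: fE; exact: near1.
  move=> x y; apply: fE.
  have near_comb k : near P ((x + k *: y) ^+ 2) ((f x + k * f y) ^+ 2).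
    by apply: near_sqr => //; apply: nearD => //; exact: nearZ.
  have -> : f x * f y =
      4^-1 * ((f x + 1 * f y) ^+ 2 + (-1) * (f x + (-1) * f y) ^+ 2) by field.
  have -> : x * y =
      4^-1 *: ((x + 1 *: y) ^+ 2 + (-1) *: (x + (-1) *: y) ^+ 2).
    rewrite scaleN1r scale1r scaleN1r.
    have -> : (x + y) ^+ 2 - (x - y) ^+ 2 = (4 : R) *: (x * y).
      by rewrite scaler_nat; ring.
    by rewrite scalerA mulVf ?scale1r // pnatr_eq0.
  exact: (nearZ _ qP (nearD qP (near_comb 1) (nearZ (-1) qP (near_comb (-1))))).
pose fL := GRing.isLinear.Build R A R *%R f f_linear.
pose fM := GRing.isMonoidMorphism.Build A R f f_monoid.
pose chi : character A := HB.pack_for {lrmorphism A -> R | *%R} f fL fM.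
by exists chi => x Px; exact: near_ge0 Px (fP x).
Qed.

(** * Positivity on characters *)

(** The gain [k ^- 2] comes from the identity
    [k^2 (a + r) - 1 = (k - s)^2 (a + r) + 2 k (s a - 1) + r s (2 k - s)
      + (2 k - 1 - s^2 a)].
    The constraints on [k] do not involve [r], so the step can be repeated
    with the same gain until [r] is negative. *)
Lemma archimedean_certificate_step C a s k r :
  quadratic_module C -> sos s -> C (s * a - 1) -> 0 < k ->
  C ((2 * k)%:A - s) -> C ((2 * k - 1)%:A - s ^+ 2 * a) -> 0 <= r ->
  C (a + r%:A) -> C (a + (r - k ^- 2)%:A).
Proof.
move=> qC ss Csa k0 Cks Cksa r0 Car.
have Csks : C (s * ((2 * k)%:A - s)).
  apply: (@qmZ_inv _ (2 * k)) => //; first by rewrite mulr_gt0.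
  have -> : (2 * k) *: (s * ((2 * k)%:A - s)) =
     s * ((2 * k)%:A - s) ^+ 2 + s ^+ 2 * ((2 * k)%:A - s).
    by rewrite -[_ *: (s * _)]mulr_algl; ring.
  apply: (qmD qC); last exact: qm_sqrM.
  by apply: sosM => //; exact: qm_sqr.
apply: (@qmZ_inv _ (k ^+ 2)) => //; first by rewrite exprn_gt0.
have -> : k ^+ 2 *: (a + (r - k ^- 2)%:A) =
    (k%:A - s) ^+ 2 * (a + r%:A) + (2 * k) *: (s * a - 1) +
    r *: (s * ((2 * k)%:A - s)) + ((2 * k - 1)%:A - s ^+ 2 * a).
  have -> : (r - k ^- 2)%:A = r%:A - (k ^- 2)%:A :> A by rewrite scalerBl.
  rewrite addrA scalerBr scalerA mulfV ?scale1r;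
    last by rewrite expf_neq0// gt_eqF.
  rewrite !(scalerBl (2 * k) 1) -[(2 * k) *: (s * a - 1)]mulr_algl.
  rewrite -[_ *: (s * _)]mulr_algl -[k ^+ 2 *: _]mulr_algl.
  rewrite -!(scalerA 2 k) scaler_nat.
  have -> : (k ^+ 2)%:A = k%:A ^+ 2 :> A by rewrite exprZn expr1n.
  by rewrite !scale1r; ring.
apply: (qmD qC) => //; apply: (qmD qC); last exact: qmZ.
apply: (qmD qC); first exact: qm_sqrM.
by apply: qmZ => //; rewrite mulr_ge0 ?ltW.
Qed.

Lemma archimedean_certificate C a s : quadratic_module C -> archimedean C ->
  sos s -> C (s * a - 1) -> exists2 e, 0 < e & C (a - e%:A).
Proof.
move=> qC archC ss Csa.
have [l1 l10 [Cl1 _]] := archC s.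
have [l2 l20 [Cl2 _]] := archC (s ^+ 2 * a).
(* Large enough for l1 <= 2 k and l2 <= 2 k - 1. *)
pose k := l1 + l2 + 1.
have k0 : 0 < k by rewrite /k; lra.
have Cge l l' x : l <= l' -> C (l%:A + x) -> C (l'%:A + x).
  move=> ll' Cx; have : C (l' - l)%:A by apply: qm_scalar; rewrite ?subr_ge0.
  by move/(fun H => qmD qC H Cx); rewrite addrA -scalerDl subrK.
have Cks : C ((2 * k)%:A - s) by apply: (Cge l1) => //; rewrite /k; lra.
have Cksa : C ((2 * k - 1)%:A - s ^+ 2 * a).
  by apply: (Cge l2) => //; rewrite /k; lra.
have step r := @archimedean_certificate_step C a s k r qC ss Csa k0 Cks Cksa.
pose e := k ^- 2; have e0 : 0 < e by rewrite invr_gt0 exprn_gt0.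
have descent n : C (a + (n%:R * e)%:A) -> C (a - e%:A).
  have ne0 m : 0 <= m%:R * e by exact: mulr_ge0 (ler0n _ _) (ltW e0).
  elim: n => [|n IHn] Cn; have := step _ (ne0 _) Cn; rewrite -/e.
    by rewrite mul0r sub0r scaleNr.
  by rewrite -natr1 mulrDl mul1r addrK; exact: IHn.
have [l l0 [_ Cla]] := archC a.
exists e => //; apply: (descent (Num.bound (l / e))).
rewrite addrC; apply: (Cge l) => //.
by rewrite -ler_pdivrMr// ltW// archi_boundP// divr_ge0// ltW.
Qed.

(** Either [-1] has the form [c - s a], which certifies the positivity of [a],
    or a maximal proper quadratic module containing [C] and [- a] has a
    character that contradicts the positivity of [a]. *)
Lemma jacobi_positivstellensatz C a : quadratic_module C -> archimedean C ->
  (forall chi : character A, (forall c, C c -> 0 <= chi c) -> 0 < chi a) ->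
  exists2 e, 0 < e & C (a - e%:A).
Proof.
move=> qC archC posa.
have [[c [s [Cc ss eq1]]]|proper_a] := pselect (adjoin C (- a) (- 1)).
  apply: (archimedean_certificate (s := s)) => //.
  by rewrite eq1 mulrN addrCA subrr addr0.
have [P [qP sub_P maxP]] := exists_maximal_proper (adjoin_qm (- a) qC) proper_a.
have CP : C `<=` P by apply: (subset_trans _ sub_P); exact: sub_adjoin.
have [chi chiP] := maximal_proper_character qP (archimedeanS CP archC) maxP.
have : 0 < chi a by apply: posa => c /CP; exact: chiP.
have : 0 <= chi (- a) by apply/chiP/sub_P; exact: mem_adjoin.
by rewrite raddfN oppr_ge0 => /le_lt_trans h /h; rewrite ltxx.
Qed.

(** * The cone generated by the products of two cones *)

Lemma cone_prod_mul M Q m q : M m -> Q q -> cone_prod M Q (m * q).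
Proof.
by move=> Mm Qq; exists 1, (fun=> m), (fun=> q); rewrite big_ord1.
Qed.

(** In each product the factor in [M] absorbs a nonnegative scalar and the
    factor in [Q] absorbs a square. *)
Lemma cone_prod_qm M Q : unital_cone M -> quadratic_module Q ->
  quadratic_module (cone_prod M Q).
Proof.
move=> [[MZ MD] M1] qQ; have [[_ Q1] _] := qQ.
split; first split; first split.
- move=> l _ l0 [n [m [q [Mm Qq ->]]]]; exists n, (fun i => l *: m i), q.
  split=> // [i|]; first exact: MZ.
  by rewrite scaler_sumr; apply: eq_bigr => i _; rewrite scalerAl.
- move=> _ _ [n [m [q [Mm Qq ->]]]] [n' [m' [q' [Mm' Qq' ->]]]].
  pose glue (f : 'I_n -> A) (g : 'I_n' -> A) (i : 'I_(n + n')) :=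
    match fintype.split i with inl j => f j | inr j => g j end.
  exists (n + n')%N, (glue m m'), (glue q q').
  split=> [i|i|]; [by rewrite /glue; case: fintype.split| |].
    by rewrite /glue; case: fintype.split.
  rewrite big_split_ord; congr (_ + _); apply: eq_bigr => i _.
    by rewrite /glue -[lshift _ _]/(unsplit (inl i)) unsplitK.
  by rewrite /glue -[rshift _ _]/(unsplit (inr i)) unsplitK.
- by rewrite -(mulr1 1); exact: cone_prod_mul.
- move=> b _ [n [m [q [Mm Qq ->]]]]; exists n, m, (fun i => b ^+ 2 * q i).
  split=> // [i|]; first exact: qm_sqrM.
  by rewrite mulr_sumr; apply: eq_bigr => i _; rewrite mulrCA.
Qed.

End Positivstellensatz.

Theorem corollary4 (R : realType) (A : comAlgType R) (Q M : set A) (a : A)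
    (hQ : quadratic_module Q) (hQarch : archimedean Q) (hM : unital_cone M)
    (ha : forall chi : character A,
        chi \in char_on M `&` char_on Q -> 0 < chi a) :
  exists2 eps : R, 0 < eps & exists2 c : A, c \in cone_prod M Q & a = eps%:A + c.
Proof.
have [[_ M1] [[_ Q1] _]] := (hM, hQ).
have QC : Q `<=` cone_prod M Q.
  by move=> q Qq; rewrite -(mul1r q); exact: cone_prod_mul.
have MC : M `<=` cone_prod M Q.
  by move=> m Mm; rewrite -(mulr1 m); exact: cone_prod_mul.
have [||chi chiC|e e0 Ce] := @jacobi_positivstellensatz _ _ (cone_prod M Q) a.
- exact: cone_prod_qm.
- exact: archimedeanS hQarch.
- by apply: ha; rewrite inE; split=> c => [/MC|/QC]; exact: chiC.
by exists e => //; exists (a - e%:A); rewrite ?inE// addrC subrK.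
Qed.
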